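(* Let $f:\mathbb{R}^d\to\mathbb{R}$ be differentiable, bounded from below and $L$-smooth. Let $\mathcal{D}$ be a probability distribution on $\mathbb{R}^d$ such that (i) $\mathbb{E}_{s\sim\mathcal{D}}[\|s\|_2^2]<\infty$; (ii) there are a norm $\|\cdot\|_{\mathcal{D}}$ on $\mathbb{R}^d$ and a constant $\mu_{\mathcal{D}}>0$ with $\mathbb{E}_{s\sim\mathcal{D}}|\langle v,s\rangle|\ge\mu_{\mathcal{D}}\|v\|_{\mathcal{D}}$ for all $v\in\mathbb{R}^d$; (iii) $\mathbb{P}_{s\sim\mathcal{D}}(\|s\|_2\le 1)=1$. Let $\{\theta^t\}_{t\ge1}$ be generated by the Stochastic Three Points (STP) algorithm with (deterministic, positive) step sizes $\{\alpha_t\}_{t\ge1}$ satisfying $\sum_{t=1}^\infty\alpha_t^2<\infty$ and $\sum_{t=1}^\infty\alpha_t=\infty$. Then $$\lim_{T\to\infty}\mathbb{E}\left[\|\nabla f(\theta^T)\|_{\mathcal{D}}\right]=0.$$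
   Context: $L$-smooth means $\|\nabla f(x)-\nabla f(y)\|_2\le L\|x-y\|_2$ for all $x,y\in\mathbb{R}^d$. STP algorithm: given a deterministic initial point $\theta^1\in\mathbb{R}^d$, step sizes $\alpha_t>0$ and the distribution $\mathcal{D}$, for $t=1,2,\ldots$ draw a random vector $s_t\sim\mathcal{D}$ (the $s_t$ being independent) and set $\theta^{t+1}\in\arg\min_{\theta\in\{\theta^t,\ \theta^t+\alpha_ts_t,\ \theta^t-\alpha_ts_t\}}f(\theta)$, with ties broken by a fixed measurable rule depending only on $(t,\theta^t,s_t)$. *)

(* Defs.v *)
From HB Require Import structures.
From mathcomp Require Import all_boot all_order all_algebra finmap.
From mathcomp Require Import all_classical all_reals all_analysis.

Set Implicit Arguments.
Unset Strict Implicit.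
Unset Printing Implicit Defensive.

Import Order.TTheory GRing.Theory Num.Theory.
Import numFieldNormedType.Exports.

Local Open Scope classical_set_scope.
Local Open Scope ring_scope.

(* R^d with its Borel sigma-algebra. The topology on 'rV[R]_d is the library's
   (sup norm), which is the usual one. The carrier is convertible to 'rV[R]_d. *)
Notation borel_rV R d := (g_sigma_algebraType (@open 'rV[R]_d)).

Section euclidean.
Context {R : realType} {d : nat}.
Implicit Types u v x : 'rV[R]_d.

Definition dotp u v : R := \sum_(i < d) u 0 i * v 0 i.

(* Not `|u|, which is the sup norm on 'rV[R]_d. *)
Definition enorm u : R := Num.sqrt (dotp u u).

Definition grad (f : 'rV[R]_d -> R) x : 'rV[R]_d :=
  \row_(i < d) 'D_(delta_mx 0 i) f x.

Definition smooth (L : R) (f : 'rV[R]_d -> R) : Prop :=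
  forall x y, enorm (grad f x - grad f y) <= L * enorm (x - y).

Definition bounded_below (f : 'rV[R]_d -> R) : Prop :=
  exists m : R, forall x, m <= f x.

End euclidean.

(* Nonnegativity of N follows from the first two clauses. *)
Definition is_norm (R : realType) (V : lmodType R) (N : V -> R) : Prop :=
  [/\ forall x y, N (x + y) <= N x + N y,
      forall (a : R) x, N (a *: x) = `|a| * N x
    & forall x, N x = 0 -> x = 0].

Definition argmin (R : realType) (T : Type) (f : T -> R) (A : set T) : set T :=
  [set y | A y /\ forall z, A z -> f y <= f z].

Definition mutually_independent (R : realType) (dO dE : measure_display)
    (Omega : measurableType dO) (P : probability Omega R)
    (E : measurableType dE) (I : set nat) (X : nat -> {RV P >-> E}) : Prop :=
  forall (J : {fset nat}) (B : nat -> set E),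
    [set` J] `<=` I -> (forall i, i \in J -> measurable (B i)) ->
    P (\bigcap_(i in [set` J]) X i @^-1` B i) =
    (\prod_(i <- J) P (X i @^-1` B i))%E.

Section stp.
Context {R : realType} {d : nat}.
Implicit Types (f : 'rV[R]_d -> R) (alpha : nat -> R).

(* The update map with its tie-breaking: a measurable selection of the argmin. *)
Definition stp_rule f alpha
    (rule : nat -> borel_rV R d * borel_rV R d -> borel_rV R d) : Prop :=
  forall t : nat, (1 <= t)%N ->
    measurable_fun [set: borel_rV R d * borel_rV R d] (rule t) /\
    forall x s : 'rV[R]_d,
      argmin f [set x; x + alpha t *: s; x - alpha t *: s] (rule t (x, s)).

(* Time runs over t = 1, 2, ...; alpha 0, s 0 and theta 0 are unused. *)
Record STP (dO : measure_display) (Omega : measurableType dO)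
    (P : probability Omega R) f alpha (D : probability (borel_rV R d) R)
    (theta1 : 'rV[R]_d) (s : nat -> {RV P >-> borel_rV R d})
    (theta : nat -> Omega -> 'rV[R]_d) : Prop := {
  stp_law : forall t, (1 <= t)%N ->
    forall A, measurable A -> distribution P (s t) A = D A;
  stp_indep : mutually_independent [set t | (1 <= t)%N] s;
  stp_init : forall w, theta 1 w = theta1;
  stp_step : exists2 rule, stp_rule f alpha rule &
    forall t, (1 <= t)%N ->
      forall w, theta t.+1 w = rule t (theta t w, s t w)
}.

End stp.

(* Main.v *)
Require Import Defs.
From HB Require Import structures.
From mathcomp Require Import all_boot all_order all_algebra finmap.
From mathcomp Require Import all_classical all_reals all_analysis.
From mathcomp Require Import measurable_realfun.
From mathcomp Require Import ring lra.

Set Implicit Arguments.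
Unset Strict Implicit.
Unset Printing Implicit Defensive.

Import Order.TTheory GRing.Theory Num.Theory.
Import numFieldNormedType.Exports.

Local Open Scope classical_set_scope.
Local Open Scope ring_scope.

(* Since the update keeps the best of the three candidate points, smoothness
   gives f(theta_{t+1}) + alpha_t |<grad f(theta_t), s_t>| <=
   f(theta_t) + |L| alpha_t^2 almost surely. As theta_t is independent of s_t,
   the expectation of the middle term is at least
   alpha_t muD E normD(grad f(theta_t)), so that sum_t alpha_t G_t < oo for
   G_t := E normD(grad f(theta_t)). As sum_t alpha_t = oo, G_t is small
   infinitely often, and since |theta_{t+1} - theta_t| <= alpha_t, G increases
   by at most C alpha_t per step, which prevents it from becoming large again. *)

(** * Euclidean geometry and descent *)

Section euclidean_space.
Context {R : realType} {d : nat}.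
Implicit Types u v x y : 'rV[R]_d.

Lemma dotp_ge0 u : 0 <= dotp u u.
Proof. by apply: sumr_ge0 => i _; rewrite -expr2 sqr_ge0. Qed.

Lemma sqr_enorm u : enorm u ^+ 2 = dotp u u.
Proof. by rewrite sqr_sqrtr // dotp_ge0. Qed.

Lemma enorm_ge0 u : 0 <= enorm u.
Proof. exact: sqrtr_ge0. Qed.

Lemma dotpBl u v x : dotp (u - v) x = dotp u x - dotp v x.
Proof. by rewrite /dotp -sumrB; apply: eq_bigr => i _; rewrite !mxE mulrBl. Qed.

Lemma dotpZr a u v : dotp u (a *: v) = a * dotp u v.
Proof.
by rewrite /dotp mulr_sumr; apply: eq_bigr => i _; rewrite mxE mulrCA.
Qed.

Lemma enormZ a u : enorm (a *: u) = `|a| * enorm u.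
Proof.
rewrite /enorm -sqrtr_sqr -sqrtrM ?sqr_ge0 //; congr Num.sqrt.
by rewrite /dotp mulr_sumr; apply: eq_bigr => i _; rewrite !mxE; ring.
Qed.

Lemma sqr_coord_le_dotp u i : u 0 i ^+ 2 <= dotp u u.
Proof.
rewrite /dotp (bigD1 i) //= -expr2 lerDl.
by apply: sumr_ge0 => j _; rewrite -expr2 sqr_ge0.
Qed.

Lemma coord_le_enorm u i : `|u 0 i| <= enorm u.
Proof. by rewrite -sqrtr_sqr ler_wsqrtr // sqr_coord_le_dotp. Qed.

(** With [a = dotp v v] and [b = dotp u v], the nonnegative sum of squares in [E] equals [dotp v v]
    times the Gram determinant of [u] and [v]. *)
Lemma cauchy_schwarz_dotp u v : `|dotp u v| <= enorm u * enorm v.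
Proof.
have E a b : \sum_(i < d) (a * u 0 i - b * v 0 i) ^+ 2 =
    a ^+ 2 * dotp u u - 2 * (a * b) * dotp u v + b ^+ 2 * dotp v v.
  rewrite /dotp !mulr_sumr -sumrB -big_split /=.
  by apply: eq_bigr => i _; ring.
rewrite -sqrtr_sqr /enorm -sqrtrM ?dotp_ge0 // ler_wsqrtr //.
have [v0|v_neq0] := eqVneq (dotp v v) 0.
  rewrite v0 mulr0 /dotp big1 ?expr0n // => i _.
  have /eqP : v 0 i ^+ 2 = 0.
    by apply: le_anti; rewrite sqr_ge0 andbT -v0 sqr_coord_le_dotp.
  by rewrite sqrf_eq0 => /eqP ->; rewrite mulr0.
have v_gt0 : 0 < dotp v v by rewrite lt_neqAle eq_sym v_neq0 dotp_ge0.
have : 0 <= \sum_(i < d) (dotp v v * u 0 i - dotp u v * v 0 i) ^+ 2.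
  by apply: sumr_ge0 => i _; exact: sqr_ge0.
rewrite E => H; rewrite -(ler_pM2l v_gt0) -subr_ge0.
by apply: le_trans H _; rewrite le_eqVlt; apply/orP; left; apply/eqP; ring.
Qed.

(** The topology on row vectors comes from the sup norm; this bound carries Euclidean estimates over
    to it. *)
Lemma enorm_le_norm u : enorm u <= Num.sqrt d%:R * `|u|.
Proof.
have -> : `|u| = Num.sqrt (`|u| ^+ 2) by rewrite sqrtr_sqr normr_id.
rewrite -sqrtrM // ler_wsqrtr //.
apply: (@le_trans _ _ (\sum_(i < d) `|u| ^+ 2)); last first.
  by rewrite sumr_const card_ord mulr_natl.
apply: ler_sum => i _; rewrite -expr2 -real_normK ?num_real //.
rewrite lerXn2r ?nnegrE // {2}/Num.norm /= mx_normrE.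
exact: (le_bigmax _ (fun ij : 'I_1 * 'I_d => `|u ij.1 ij.2|) (0, i)).
Qed.

(** * Arbitrary norms compared with the Euclidean norm *)

Lemma is_norm_sum_le (N : 'rV[R]_d -> R) (I : Type) (r : seq I)
    (F : I -> 'rV[R]_d) : is_norm N ->
  N (\sum_(i <- r) F i) <= \sum_(i <- r) N (F i).
Proof.
case=> ND NZ _; elim: r => [|i r IH].
  by rewrite !big_nil -(scale0r 0) NZ normr0 mul0r.
by rewrite !big_cons (le_trans (ND _ _)) // lerD2l.
Qed.

Lemma is_norm_ge0 (N : 'rV[R]_d -> R) u : is_norm N -> 0 <= N u.
Proof.
case=> ND NZ _; have := ND u (-1 *: u).
by rewrite NZ scaleN1r subrr -(scale0r 0) NZ normr0 normrN1; lra.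
Qed.

(** One half of the equivalence of norms: expand [u] in the standard basis and sum the norms of the
    basis vectors. *)
Lemma is_norm_le_enorm (N : 'rV[R]_d -> R) : is_norm N ->
  exists2 C, 0 <= C & forall u, N u <= C * enorm u.
Proof.
move=> N_norm; exists (\sum_(i < d) N (delta_mx 0 i)).
  by apply: sumr_ge0 => i _; exact: is_norm_ge0.
move=> u; rewrite [X in N X](row_sum_delta u) (le_trans (is_norm_sum_le _ _ N_norm)) //.
rewrite mulr_suml; apply: ler_sum => i _; case: (N_norm) => _ NZ _.
by rewrite NZ mulrC ler_wpM2l ?is_norm_ge0 ?coord_le_enorm.
Qed.

Lemma is_norm_dist_le (N : 'rV[R]_d -> R) u v : is_norm N ->
  `|N u - N v| <= N (u - v).
Proof.
case=> ND NZ _; have Nsym : N (v - u) = N (u - v).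
  by rewrite -opprB -scaleN1r NZ normrN1 mul1r.
by have := ND (u - v) v; have := ND (v - u) u; rewrite !subrK ler_norml Nsym; lra.
Qed.

Lemma enorm_lipschitz_continuous (h : 'rV[R]_d -> R) (K : R) :
  (forall x y, `|h x - h y| <= K * enorm (x - y)) -> continuous h.
Proof.
move=> hK x; apply/(@cvgrPdist_lt _ _ _ _ (nbhs_filter x)) => /= e e_gt0.
(* The absolute value covers a negative [K], and the [+ 1] keeps [c] positive so that one can divide
   by it. *)
pose c := `|K| * Num.sqrt d%:R + 1.
have c_gt0 : 0 < c by rewrite ltr_wpDl // mulr_ge0 // sqrtr_ge0.
near=> y; apply: (@le_lt_trans _ _ (c * `|x - y|)).
  apply: le_trans (hK _ _) _.
  apply: (@le_trans _ _ (`|K| * enorm (x - y))).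
    by rewrite ler_wpM2r ?enorm_ge0 // ler_norm.
  apply: (@le_trans _ _ (`|K| * (Num.sqrt d%:R * `|x - y|))).
    by rewrite ler_wpM2l // enorm_le_norm.
  by rewrite mulrA ler_wpM2r // lerDl.
rewrite mulrC -ltr_pdivlMr //; near: y.
have e_c : 0 < e / c by exact: divr_gt0.
exact: (@cvgr_dist_lt R 'rV[R]_d _ (nbhs x) (nbhs_filter x) id x (@cvg_id _ (nbhs x)) _ e_c).
Unshelve. all: by end_near.
Qed.

(** [grad] records only the partial derivatives; linearity of the differential recovers all other
    directions. *)
Lemma derive_dotp_grad (f : 'rV[R]_d -> R) x v : differentiable f x ->
  'D_v f x = dotp (grad f x) v.
Proof.
move=> df; rewrite deriveE // [in LHS](row_sum_delta v) linear_sum /dotp.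
by apply: eq_bigr => i _; rewrite linearZ mxE deriveE // mulrC.
Qed.

Lemma is_derive_along_line (f : 'rV[R]_d -> R) x v (t : R) :
  differentiable f (x + t *: v) ->
  is_derive t 1 (fun r : R => f (x + r *: v)) (dotp (grad f (x + t *: v)) v).
Proof.
move=> df; rewrite -derive_dotp_grad //.
have E : (fun h : R => h^-1 *: (f (x + (h *: 1 + t) *: v) - f (x + t *: v))) =
    (fun h : R => h^-1 *: (f (h *: v + (x + t *: v)) - f (x + t *: v))).
  by apply/funext => h; rewrite /= [h *: 1]mulr1 scalerDl addrCA.
have dv : derivable f (x + t *: v) v by exact: diff_derivable.
by split; rewrite /derivable /derive /= /shift /= E.
Qed.

(* The constant L instead of L / 2 is what the mean value theorem gives. *)
Lemma smooth_descent (f : 'rV[R]_d -> R) (L : R) x v :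
  0 <= L -> (forall x, differentiable f x) -> smooth L f ->
  f (x + v) <= f x + dotp (grad f x) v + L * enorm v ^+ 2.
Proof.
move=> L_ge0 df fL.
have dg (t : R) := is_derive_along_line (df (x + t *: v)).
have g_cont : {within `[0, 1], continuous (fun r : R => f (x + r *: v))}.
  apply: continuous_subspaceT => t; apply: differentiable_continuous.
  by apply/derivable1_diffP; case: (dg t).
have [c] := MVT_segment ler01 (fun t _ => dg t) g_cont.
rewrite in_itv /= => /andP[c_ge0 c_le1].
rewrite scale1r scale0r addr0 subr0 mulr1 => E.
(* What remains is the increment of the gradient between [x] and [x + c *: v], paired with [v];
   Cauchy-Schwarz, smoothness and [c <= 1] bound it. *)
rewrite -lerBlDl opprD addrA E -dotpBl.
apply: le_trans (ler_norm _) _; apply: le_trans (cauchy_schwarz_dotp _ _) _.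
rewrite expr2 mulrA ler_wpM2r ?enorm_ge0 // (le_trans (fL _ _)) //.
rewrite addrAC subrr add0r enormZ ger0_norm // ler_wpM2l //.
by rewrite ler_piMl // enorm_ge0.
Qed.

End euclidean_space.

(** * Real series *)

(* Whenever G drops below e, each later increase of G above e is paid for by
   C / e * (u t * G t), whose sum is small. *)
Lemma cvg0_of_weighted_summable (R : realType) (u G : nat -> R) (C B : R) :
  0 <= C -> (forall t, 0 < u t) -> (forall t, 0 <= G t) ->
  u @ \oo --> (0 : R) ->
  (forall M, exists n, M < \sum_(0 <= t < n) u t) ->
  (forall n, \sum_(0 <= t < n) u t * G t <= B) ->
  (forall t, G t.+1 <= G t + C * u t) ->
  G @ \oo --> (0 : R).
Proof.
move=> C_ge0 u_gt0 G_ge0 u0 u_div uG_le GC.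
pose S n := \sum_(0 <= t < n) u t * G t.
have uG_ge0 t : 0 <= u t * G t by rewrite mulr_ge0 // ltW.
have S_rec n : S n.+1 = S n + u n * G n by rewrite /S big_nat_recr.
have S_nd : nondecreasing_seq S.
  by apply/nondecreasing_seqP => n; rewrite S_rec lerDl.
have S_cvg : cvgn S.
  by apply: nondecreasing_is_cvgn => //; exists B => _ [n _ <-]; exact: uG_le.
have S_le n : S n <= limn S by exact: nondecreasing_cvgn_le.
apply/cvgrPdist_lt => /= e e_gt0.
(* Three errors of size at most [e'] add up at the end, which stays below [e]. *)
pose e' := e / 4; have e'_gt0 : 0 < e' by rewrite /e'; lra.
pose k := C / e'.
have k_ge0 : 0 <= k by rewrite divr_ge0 // ltW.
have C1_gt0 : 0 < C + 1 by lra.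
have k1_gt0 : 0 < k + 1 by lra.
(* From [N] on, one step raises [G] by at most [e'], and all later payments together cost at most
   [e']. *)
have [N _ HN] : \forall n \near \oo,
    C * u n <= e' /\ k * (limn S - S n) <= e'.
  near=> n; split.
    have un : `|0 - u n| < e' / (C + 1).
      by near: n; move/cvgrPdist_lt : u0; apply; rewrite divr_gt0.
    rewrite sub0r normrN (gtr0_norm (u_gt0 _)) ltr_pdivlMr // in un.
    by have := u_gt0 n; nra.
  have Sn : `|limn S - S n| < e' / (k + 1).
    by near: n; move/cvgrPdist_lt : S_cvg; apply; rewrite divr_gt0.
  rewrite ger0_norm ?subr_ge0 // ltr_pdivlMr // in Sn.
  by have := S_le n; nra.
(* If [G] stayed at or above [e'] from [N] on, then [u t <= u t * G t / e'] would bound the partial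
   sums of [u]. *)
have [t0 Nt0 Gt0] : exists2 t0, (N <= t0)%N & G t0 < e'.
  apply: contrapT => noG.
  have G_ge t : (N <= t)%N -> e' <= G t.
    by move=> Nt; rewrite leNgt; apply/negP => Gt; apply: noG; exists t.
  have [n] := u_div (\sum_(0 <= t < N) u t + B / e').
  suff : \sum_(0 <= t < n) u t <= \sum_(0 <= t < N) u t + B / e' by lra.
  have bound m : \sum_(0 <= t < m) u t <= \sum_(0 <= t < N) u t + S m / e'.
    elim: m => [|m IH].
      rewrite /S !big_nil mul0r addr0; apply: sumr_ge0 => i _; exact: ltW.
    have [Nm|mN] := leqP N m.
      rewrite big_nat_recr //= S_rec mulrDl addrA lerD //.
      by rewrite ler_pdivlMr // ler_wpM2l ?G_ge // ltW.
    rewrite (big_cat_nat (leq0n m.+1) mN) /= -addrA lerDl addr_ge0 //.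
      by apply: sumr_ge0 => i _; exact: ltW.
    by rewrite divr_ge0 ?sumr_ge0 // ltW.
  by apply: le_trans (bound n) _; rewrite lerD2l ler_wpM2r ?invr_ge0 ?uG_le // ltW.
(* If [G t < e'], one step reaches at most [e' + e']. Otherwise [C * u t <= k * (u t * G t)], which
   is exactly the growth of the last term. *)
have inv n : G (t0 + n)%N <= e' + e' + k * (S (t0 + n)%N - S t0).
  elim: n => [|n IH]; first by rewrite addn0 subrr mulr0; lra.
  rewrite addnS S_rec; set t := (t0 + n)%N in IH *.
  have Nt : (N <= t)%N by rewrite (leq_trans Nt0) ?leq_addr.
  have := S_nd _ _ (leq_addr n t0); rewrite -/t => S_t.
  have [Cu _] := HN _ Nt; have := GC t.
  have [Gt|Gt] := ltP (G t) e'.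
    by have := uG_ge0 t; nra.
  have : C * u t <= k * (u t * G t).
    rewrite /k -mulrA ler_wpM2l // ler_pdivlMl // mulrC ler_wpM2l //.
    exact: ltW.
  by lra.
exists t0 => // t /= t0t; rewrite sub0r normrN ger0_norm //.
have := inv (t - t0)%N; rewrite subnKC // => Gt.
have [_ kS] := HN _ Nt0.
have : k * (S t - S t0) <= k * (limn S - S t0) by rewrite ler_wpM2l // lerD2r.
by rewrite /e' in Gt kS *; lra.
Unshelve. all: by end_near.
Qed.

Lemma nneseries_partial_sum_le (R : realType) (u : nat -> R) :
  (forall t, (1 <= t)%N -> 0 <= u t) ->
  (\sum_(1 <= t <oo) (u t)%:E < +oo)%E ->
  exists A, forall n, \sum_(0 <= t < n) u t.+1 <= A.
Proof.
move=> u_ge0 u_fin; set S := (\sum_(1 <= t <oo) _)%E in u_fin.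
have uE_ge0 t : (1 <= t)%N -> true -> (0 <= (u t)%:E)%E.
  by move=> t_ge1 _; rewrite lee_fin u_ge0.
have S_fin : S \is a fin_num by rewrite ge0_fin_numE // nneseries_ge0.
exists (fine S) => n; rewrite -lee_fin fineK // -sumEFin.
have := nneseries_lim_ge (P := xpredT) n.+1 uE_ge0.
by rewrite big_add1.
Qed.

Lemma nneseries_pinfty_partial_sum (R : realType) (u : nat -> R) :
  (forall t, (1 <= t)%N -> 0 <= u t) ->
  (\sum_(1 <= t <oo) (u t)%:E = +oo)%E ->
  forall M, exists n, M < \sum_(0 <= t < n) u t.+1.
Proof.
move=> u_ge0 u_oo M; apply: contrapT => noM.
suff : (\sum_(1 <= t <oo) (u t)%:E <= M%:E)%E by rewrite u_oo leye_eq.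
apply: lime_le.
  by apply: is_cvg_nneseries => t t_ge1 _; rewrite lee_fin u_ge0.
apply: nearW => -[|n]; rewrite sumEFin lee_fin.
  (* The range from 1 to 0 is empty; a negative [M] is already exceeded by the empty sum. *)
  rewrite big_geq // leNgt; apply/negP => M_lt0; apply: noM.
  by exists 0%N; rewrite big_nil.
by rewrite big_add1 leNgt; apply/negP => M_lt; apply: noM; exists n.
Qed.

Lemma cvg0_of_sqr_summable (R : realType) (u : nat -> R) (A : R) :
  (forall n, \sum_(0 <= t < n) u t ^+ 2 <= A) -> u @ \oo --> (0 : R).
Proof.
move=> u_le; pose v t := u t ^+ 2.
have v_cvg : cvgn (series v).
  apply: nondecreasing_is_cvgn; last by exists A => _ [n _ <-]; exact: u_le.
  apply/nondecreasing_seqP => n.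
  by rewrite /series /= big_nat_recr //= lerDl sqr_ge0.
have v0 := cvg_series_cvg_0 v_cvg.
apply/cvgrPdist_lt => e e_gt0; near=> t.
have : `|0 - v t| < e ^+ 2.
  by near: t; move/cvgrPdist_lt : v0; apply; rewrite exprn_gt0.
rewrite !sub0r !normrN ger0_norm ?sqr_ge0 // /v -real_normK ?num_real //.
by rewrite ltr_pXn2r ?nnegrE // ltW.
Unshelve. all: by end_near.
Qed.

(** * Independence *)

Lemma continuous_measurable_rV (R : realType) (d : nat) (h : 'rV[R]_d -> R) :
  continuous h -> measurable_fun [set: borel_rV R d] (h : borel_rV R d -> R).
Proof.
move=> /continuousP h_cont.
apply: (measurability _ (RGenOpens.measurableE R)) => _ [_ [a [b ->] <-]].
by rewrite setTI; apply: sub_sigma_algebra; exact/h_cont/interval_open.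
Qed.

Section independence.
Context {R : realType} {dO : measure_display} {Omega : measurableType dO}.
Context (P : probability Omega R).

(** Uniqueness of measures: both sides are finite measures of [C] that agree on rectangles, a
    generating family stable under intersection. *)
Lemma pair_indep_event (d1 d2 : measure_display) (T1 : measurableType d1)
    (T2 : measurableType d2) (Z : Omega -> T1 * T2) (E : set Omega) :
  measurable_fun setT Z -> measurable E ->
  (forall A B, measurable A -> measurable B ->
    P (Z @^-1` (A `*` B) `&` E) = (P (Z @^-1` (A `*` B)) * P E)%E) ->
  forall C, measurable C -> P (Z @^-1` C `&` E) = (P (Z @^-1` C) * P E)%E.
Proof.
move=> mZ mE indep.
have PE_fin : P E \is a fin_num by exact: fin_num_measure.
have PE_ge0 : 0 <= fine (P E) by rewrite fine_ge0.
pose m1 : {measure set (T1 * T2) -> \bar R} := pushforward (mrestr P mE) Z.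
pose m2 : {measure set (T1 * T2) -> \bar R} :=
  mscale (NngNum PE_ge0) (pushforward P Z).
have m2E C : m2 mZ C = (P (Z @^-1` C) * P E)%E.
  by rewrite /m2 /= /mscale /= fineK // muleC.
move=> C mC; rewrite -m2E -[LHS]/(m1 mZ C).
pose G := [set C : set (T1 * T2) | exists A, measurable A /\
  exists B, measurable B /\ C = A `*` B].
apply: (measure_unique G (fun=> setT)) => //.
- rewrite measurable_prod_measurableType //; congr (<<s _ >>).
  rewrite predeqE; split => [[A mA [B mB <-]]|[A [mA [B [mB ->]]]]].
    by exists A; split => //; exists B.
  by exists A => //; exists B.
- move=> _ _ [A [mA [B [mB ->]]]] [A' [mA' [B' [mB' ->]]]].
  rewrite -setXI; exists (A `&` A'); split; first exact: measurableI.
  by exists (B `&` B'); split => //; exact: measurableI.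
- by move=> _; exists setT; split => //; exists setT; split => //; rewrite setXTT.
- by rewrite bigcup_const.
- by move=> _ [A [mA [B [mB ->]]]]; rewrite m2E -indep.
- by move=> _; rewrite /m1 /= /pushforward /mrestr /= -ge0_fin_numE ?fin_num_measure //;
    rewrite preimage_setT setTI.
Qed.

(** The hypothesis on rectangles identifies the joint law of [X] and [Y] with the product of the law
    of [X] and [Q]; Tonelli then splits the integral. *)
Lemma integral_indep_pair (d1 d2 : measure_display) (T1 : measurableType d1)
    (T2 : measurableType d2) (X : {RV P >-> T1}) (Y : Omega -> T2)
    (Q : probability T2 R) (h : T1 * T2 -> \bar R) :
  measurable_fun setT Y ->
  (forall A B, measurable A -> measurable B ->
    P (X @^-1` A `&` Y @^-1` B) = (P (X @^-1` A) * Q B)%E) ->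
  measurable_fun setT h -> (forall z, 0 <= h z)%E ->
  (\int[P]_w h (X w, Y w) = \int[P]_w \int[Q]_y h (X w, y))%E.
Proof.
move=> mY indep mh h_ge0.
have mXY : measurable_fun setT (fun w => (X w, Y w)).
  exact: measurable_fun_pair.
pose m : {measure set (T1 * T2) -> \bar R} :=
  pushforward P (fun w => (X w, Y w)).
transitivity (\int[m mXY]_z h z)%E.
  by rewrite ge0_integral_pushforward // preimage_setT.
rewrite (eq_measure_integral (distribution P X \x Q)%E); last first.
  move=> C mC _; apply/esym; exact: product_measure_unique.
rewrite fubini_tonelli1 // ge0_integral_distribution //.
- exact: measurable_fun_fubini_tonelli_F.
- by move=> y; apply: integral_ge0.
Qed.

End independence.

Section cylinders.
Context {R : realType} {dO dE : measure_display} {Omega : measurableType dO}.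
Context {P : probability Omega R} {T : measurableType dE}.
Context (X : nat -> {RV P >-> T}).

(** Has the shape of the intersection in [mutually_independent], so that unfolding it makes
    independence applicable. *)
Definition cylinder (J : {fset nat}) (B : nat -> set T) : set Omega :=
  \bigcap_(i in [set` J]) X i @^-1` B i.

Lemma measurable_cylinder J B : (forall i, i \in J -> measurable (B i)) ->
  measurable (cylinder J B).
Proof.
move=> mB; apply: bigcap_measurableType => i iJ.
by apply: measurable_funPTI; exact: mB.
Qed.

Lemma cylinder0 B : cylinder fset0 B = setT.
Proof. by rewrite /cylinder set_fset0 bigcap_set0. Qed.

(** Since [t] is outside [J], overwriting [B] at [t] leaves the other constraints intact; this moves
    one event into or out of a cylinder. *)
Lemma cylinderU1 t J B A : t \notin J ->
  cylinder (t |` J)%fset (fun i => if i == t then A else B i) =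
  X t @^-1` A `&` cylinder J B.
Proof.
move=> tJ; rewrite /cylinder set_fsetU1 bigcap_setU1 eqxx; congr (_ `&` _).
apply: eq_bigcapr => i iJ; case: eqP => // it.
by move: tJ; rewrite -it iJ.
Qed.

(** Use the product formula for [J] and for [J] enlarged by [t], and compare. *)
Lemma mutually_independent_cylinderU1 (I : set nat) t J B A :
  mutually_independent I X -> I t -> [set` J] `<=` I -> t \notin J ->
  measurable A -> (forall i, i \in J -> measurable (B i)) ->
  P (X t @^-1` A `&` cylinder J B) = (P (X t @^-1` A) * P (cylinder J B))%E.
Proof.
move=> indep It JI tJ mA mB.
rewrite -cylinderU1 // [in RHS]/cylinder (indep J B) // /cylinder indep.
- rewrite big_fsetU1 //= eqxx; congr (_ * _)%E.
  rewrite !big_seq; apply: eq_bigr => i iJ; case: eqP => // it.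
  by move: tJ; rewrite -it iJ.
- by rewrite set_fsetU1 => i [->|/JI].
- move=> i; rewrite in_fset1U; case: eqP => //= _; exact: mB.
Qed.

End cylinders.

(** * The STP process *)

(** Phrased with sums of nonnegative terms, so that no possibly infinite integral is subtracted; [P]
    having mass 1 makes [c] its own integral. *)
Lemma ae_le_integralD_cst (R : realType) (dO : measure_display)
    (Omega : measurableType dO) (P : probability Omega R)
    (X Y Z : Omega -> R) (c : R) :
  measurable_fun setT X -> measurable_fun setT Y -> measurable_fun setT Z ->
  (forall w, 0 <= X w) -> (forall w, 0 <= Y w) -> (forall w, 0 <= Z w) ->
  0 <= c -> {ae P, forall w, X w + Z w <= Y w + c} ->
  (\int[P]_w (X w)%:E + \int[P]_w (Z w)%:E <= \int[P]_w (Y w)%:E + c%:E)%E.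
Proof.
move=> mX mY mZ X0 Y0 Z0 c0 XZY.
have -> : c%:E = (\int[P]_w (cst c%:E) w)%E.
  by rewrite integral_cst // [X in (_ * X)%E]probability_setT mule1.
rewrite -!ge0_integralD //=; try (by move=> w _; rewrite lee_fin);
  try exact/measurable_EFinP.
apply: ae_ge0_le_integral => //.
- by move=> w _; rewrite adde_ge0 // lee_fin.
- by apply: emeasurable_funD; exact/measurable_EFinP.
- by move=> w _; rewrite adde_ge0 // lee_fin.
- by apply: emeasurable_funD => //; exact/measurable_EFinP.
- by apply: filterS XZY => w XZYw _; rewrite -!EFinD lee_fin.
Qed.

(** * Measurability and regularity of the functions that enter the expectations *)

Lemma measurable_coord (R : realType) (d : nat) (i : 'I_d) :
  measurable_fun [set: borel_rV R d] (fun u : borel_rV R d => (u : 'rV[R]_d) 0 i).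
Proof. by apply: continuous_measurable_rV; exact: coord_continuous. Qed.

Lemma measurable_grad_coord (R : realType) (d : nat) (f : 'rV[R]_d -> R) (L : R)
    (i : 'I_d) : smooth L f ->
  measurable_fun [set: borel_rV R d] (fun x : borel_rV R d => grad f x 0 i).
Proof.
move=> fL; apply: continuous_measurable_rV.
apply: (@enorm_lipschitz_continuous _ _ _ L) => x y.
by apply: le_trans (fL x y); have := coord_le_enorm (grad f x - grad f y) i;
  rewrite !mxE.
Qed.

(** Going through coordinates gives measurability directly for the product of the two Borel
    sigma-algebras. *)
Lemma measurable_dotp_grad (R : realType) (d : nat) (f : 'rV[R]_d -> R) (L : R) :
  smooth L f ->
  measurable_fun setT
    (fun z : borel_rV R d * borel_rV R d => dotp (grad f z.1) z.2).
Proof.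
move=> fL; apply: measurable_sum => i; apply: measurable_funM.
  by apply: (measurableT_comp (measurable_grad_coord i fL)); exact: measurable_fst.
by apply: (measurableT_comp (measurable_coord i)); exact: measurable_snd.
Qed.

Lemma measurable_unit_ball (R : realType) (d : nat) :
  measurable [set u : borel_rV R d | enorm (u : 'rV[R]_d) <= 1].
Proof.
have mdotp : measurable_fun [set: borel_rV R d]
    (fun u : borel_rV R d => dotp (u : 'rV[R]_d) u).
  by apply: measurable_sum => i; apply: measurable_funM; exact: measurable_coord.
have -> : [set u : borel_rV R d | enorm (u : 'rV[R]_d) <= 1] =
    setT `&` (fun u : borel_rV R d => dotp (u : 'rV[R]_d) u) @^-1` `]-oo, 1].
  rewrite setTI; apply/seteqP; split=> u /=; rewrite in_itv /= -sqr_enorm.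
    by move=> u1; rewrite expr_le1 // enorm_ge0.
  by rewrite expr_le1 // enorm_ge0.
exact: mdotp.
Qed.

(** Serves twice: it makes the norm of the gradient continuous, hence measurable, and it limits its
    growth along one step. *)
Lemma is_norm_grad_dist_le (R : realType) (d : nat) (f : 'rV[R]_d -> R) (L : R)
    (N : 'rV[R]_d -> R) : smooth L f -> is_norm N ->
  exists2 C, 0 <= C &
    forall x y, `|N (grad f x) - N (grad f y)| <= C * enorm (x - y).
Proof.
move=> fL N_norm; have [C C_ge0 NC] := is_norm_le_enorm N_norm.
exists (C * `|L|) => [|x y]; first exact: mulr_ge0.
apply: le_trans (is_norm_dist_le _ _ N_norm) _; apply: le_trans (NC _) _.
rewrite -mulrA ler_wpM2l // (le_trans (fL x y)) //.
by rewrite ler_wpM2r ?enorm_ge0 ?ler_norm.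
Qed.

Section stp_process.
Context {R : realType} {d : nat} (f : 'rV[R]_d -> R) (alpha : nat -> R).
Context {dO : measure_display} {Omega : measurableType dO}.
Context {P : probability Omega R} (D : probability (borel_rV R d) R).
Context (theta1 : 'rV[R]_d) (s : nat -> {RV P >-> borel_rV R d}).
Context (theta : nat -> Omega -> 'rV[R]_d).
Context (theta_STP : STP f alpha D theta1 s theta).

Lemma stp_law_preimage t (A : set (borel_rV R d)) : (1 <= t)%N -> measurable A ->
  P (s t @^-1` A) = D A.
Proof. by move=> t_ge1 mA; rewrite -(stp_law theta_STP t_ge1 mA). Qed.

Lemma stp_measurable t : (1 <= t)%N ->
  measurable_fun setT (theta t : Omega -> borel_rV R d).
Proof.
case: theta_STP => _ _ theta_1 [rule rule_stp step].
(* The induction starts at time 1, as [theta 0] is arbitrary. *)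
case: t => // t _; elim: t => [|t IH].
  by rewrite (_ : theta 1 = cst theta1) //; apply/funext => w; exact: theta_1.
have [mrule _] := rule_stp t.+1 isT.
rewrite (_ : theta t.+2 = rule t.+1 \o (fun w => (theta t.+1 w, s t.+1 w))).
  apply: measurableT_comp mrule _; exact: measurable_fun_pair.
by apply/funext => w; exact: step.
Qed.

(* Induction on t works because the future of s is quantified over: absorbing
   s t into theta t.+1 leaves a cylinder based on the later indices. *)
Lemma stp_indep_cylinder t (A : set (borel_rV R d)) J
    (B : nat -> set (borel_rV R d)) : (1 <= t)%N -> measurable A ->
  [set` J] `<=` [set i | (t <= i)%N] -> (forall i, i \in J -> measurable (B i)) ->
  P (theta t @^-1` A `&` cylinder s J B) =
  (P (theta t @^-1` A) * P (cylinder s J B))%E.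
Proof.
case: t => // t _; elim: t A J B => [|t IH] A J B mA J_ge mB.
  (* The initial point is deterministic, so its events are empty or full. *)
  rewrite (_ : theta 1 = cst theta1); last first.
    by apply/funext => w; exact: stp_init theta_STP w.
  rewrite preimage_cst; case: ifP => _.
    by rewrite setTI probability_setT mul1e.
  by rewrite set0I measure0 mul0e.
have [rule rule_stp step] := stp_step theta_STP.
have [mrule _] := rule_stp t.+1 isT.
have mtheta := stp_measurable (isT : (1 <= t.+1)%N).
pose Z w : borel_rV R d * borel_rV R d := (theta t.+1 w, s t.+1 w).
have mZ : measurable_fun setT Z.
  exact: measurable_fun_pair.
(* The event becomes one about the pair [Z], for which it suffices to test rectangles. *)
have -> : theta t.+2 @^-1` A = Z @^-1` (rule t.+1 @^-1` A).
  by apply/seteqP; split=> w /=; rewrite step.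
have mE := measurable_cylinder s mB.
apply: pair_indep_event => //; last first.
  by rewrite -[X in measurable X]setTI; exact: mrule.
move=> A' B' mA' mB'.
have tJ : t.+1 \notin J by apply/negP => /J_ge /=; rewrite ltnn.
(* Absorb [s t.+1] into the cylinder, apply the induction hypothesis, then split it off again by the
   independence of [s]. *)
have key (K : {fset nat}) (F : nat -> set (borel_rV R d)) :
    [set` K] `<=` [set i | (t.+2 <= i)%N] ->
    (forall i, i \in K -> measurable (F i)) ->
    P (theta t.+1 @^-1` A' `&` (s t.+1 @^-1` B' `&` cylinder s K F)) =
    (P (theta t.+1 @^-1` A') * P (s t.+1 @^-1` B') * P (cylinder s K F))%E.
  move=> K_ge mF.
  have tK : t.+1 \notin K by apply/negP => /K_ge /=; rewrite ltnn.
  rewrite -cylinderU1 // IH //.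
  - rewrite cylinderU1 //.
    rewrite (mutually_independent_cylinderU1 (stp_indep theta_STP)) //.
      by rewrite muleA.
    by move=> i iK; exact: leq_trans (K_ge i iK).
  - rewrite set_fsetU1 => i [-> /=|iK]; first exact: ltnSn.
    exact: ltnW (K_ge i iK).
  - by move=> i; rewrite in_fset1U; case: eqP => //= _; exact: mF.
have -> : Z @^-1` (A' `*` B') = theta t.+1 @^-1` A' `&` s t.+1 @^-1` B' by [].
(* The empty cylinder gives the probability of the rectangle alone; [J] gives that of its
   intersection with the cylinder. *)
have := key fset0 B; rewrite cylinder0 setIT probability_setT mule1 => -> //.
by rewrite -setIA key.
Qed.

(** The cylinder over the single index [t]: the future of [theta t] includes [s t] itself. *)
Lemma stp_indep_step t (A B : set (borel_rV R d)) : (1 <= t)%N -> measurable A -> measurable B ->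
  P (theta t @^-1` A `&` s t @^-1` B) = (P (theta t @^-1` A) * D B)%E.
Proof.
move=> t_ge1 mA mB.
have t0 : t \notin (fset0 : {fset nat}) by rewrite in_fset0.
have E : cylinder s (t |` fset0)%fset (fun=> B) = s t @^-1` B.
  have := @cylinderU1 _ _ _ _ P _ s t fset0 (fun=> B) B t0.
  rewrite cylinder0 setIT => <-; congr cylinder.
  by apply/funext => i; case: ifP.
rewrite -E stp_indep_cylinder // ?E ?stp_law_preimage //.
by rewrite set_fsetU1 set_fset0 setU0 => i ->; exact: leqnn.
Qed.

(** By independence [s t] can be integrated first under [D] with [theta t] frozen, where the lower
    bound on [D] applies with the gradient as [v]. *)
Lemma stp_integral_dotp (L muD : R) (normD : 'rV[R]_d -> R) t : (1 <= t)%N ->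
  smooth L f -> is_norm normD -> 0 <= muD ->
  (forall v : 'rV[R]_d, (muD * normD v)%:E <= \int[D]_s `|dotp v s|%:E)%E ->
  (muD%:E * \int[P]_w (normD (grad f (theta t w)))%:E <=
   \int[P]_w `|dotp (grad f (theta t w)) (s t w)|%:E)%E.
Proof.
move=> t_ge1 fL N_norm mu_ge0 D_lower.
have [C _ NC] := is_norm_grad_dist_le fL N_norm.
have mN : measurable_fun [set: borel_rV R d]
    (fun x : borel_rV R d => normD (grad f x)).
  by apply: continuous_measurable_rV; exact: enorm_lipschitz_continuous NC.
have mtheta := stp_measurable t_ge1.
pose X : {RV P >-> borel_rV R d} :=
  HB.pack (theta t : Omega -> borel_rV R d)
    (isMeasurableFun.Build _ _ _ _ (theta t : Omega -> borel_rV R d) mtheta).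
pose h (z : borel_rV R d * borel_rV R d) := `|dotp (grad f z.1) z.2|%:E.
have mh : measurable_fun setT h.
  apply/measurable_EFinP; apply: measurableT_comp => //.
  exact: measurable_dotp_grad fL.
have -> : (\int[P]_w `|dotp (grad f (theta t w)) (s t w)|%:E =
    \int[P]_w \int[D]_y h (X w, y))%E.
  rewrite -(@integral_indep_pair _ _ _ _ _ _ _ _ X (s t) D h) //.
    by move=> A B mA mB; exact: stp_indep_step.
  by move=> z; rewrite lee_fin.
rewrite -ge0_integralZl_EFin //.
- apply: ge0_le_integral => //.
  + by move=> w _; rewrite -EFinM lee_fin mulr_ge0 ?is_norm_ge0.
  + apply/measurable_EFinP; apply: measurable_funM => //.
    exact: (measurableT_comp mN mtheta).
  + have h_ge0 z : (0 <= h z)%E by rewrite lee_fin.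
    have mF := measurable_fun_fubini_tonelli_F (m2 := D) h mh h_ge0.
    exact: (measurableT_comp mF mtheta).
  + by move=> w _; rewrite -EFinM; exact: D_lower.
- by move=> w _; rewrite lee_fin is_norm_ge0.
- by apply/measurable_EFinP; exact: (measurableT_comp mN mtheta).
Qed.

(** * One-step estimates for the iterates and their expectations *)

Lemma stp_ae_unit t : (1 <= t)%N -> D [set s | enorm s <= 1] = 1%E ->
  {ae P, forall w, enorm (s t w : 'rV[R]_d) <= 1}.
Proof.
move=> t_ge1 D_unit; have mB := @measurable_unit_ball R d.
exists (s t @^-1` (~` [set u : borel_rV R d | enorm (u : 'rV[R]_d) <= 1])).
split=> //.
  by apply: measurable_funPTI; exact: measurableC.
rewrite stp_law_preimage //; last exact: measurableC.
by rewrite probability_setC // D_unit subee.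
Qed.

Lemma stp_step_dist t w : (1 <= t)%N -> 0 < alpha t ->
  enorm (theta t.+1 w - theta t w) <= alpha t * enorm (s t w).
Proof.
move=> t_ge1 a_gt0; have [rule rule_stp step] := stp_step theta_STP.
have [_ rule_min] := rule_stp t t_ge1.
rewrite step //; have [[[->|->]|->] _] := rule_min (theta t w) (s t w).
- by rewrite subrr -(scale0r 0) enormZ normr0 mul0r mulr_ge0 ?enorm_ge0 // ltW.
- by rewrite addrAC subrr add0r enormZ gtr0_norm.
- by rewrite addrAC subrr add0r -scaleNr enormZ normrN gtr0_norm.
Qed.

(** Apply the descent inequality to both signs of the step; the new point is at least as good as the
    candidate whose linear term is negative. *)
Lemma stp_step_descent L t w : (1 <= t)%N -> 0 <= L ->
  (forall x, differentiable f x) -> smooth L f ->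
  f (theta t.+1 w) + alpha t * `|dotp (grad f (theta t w)) (s t w)| <=
  f (theta t w) + L * (alpha t * enorm (s t w)) ^+ 2.
Proof.
move=> t_ge1 L_ge0 df fL; have [rule rule_stp step] := stp_step theta_STP.
have [_ rule_min] := rule_stp t t_ge1.
rewrite step //; have [_ f_min] := rule_min (theta t w) (s t w).
set x := theta t w in f_min *; set y := s t w in f_min *.
have fp : f (rule t (x, y)) <= f (x + alpha t *: y).
  by apply: f_min; left; right.
have fm : f (rule t (x, y)) <= f (x + (- alpha t) *: y).
  by apply: f_min; right; rewrite scaleNr.
have := smooth_descent x (alpha t *: y) L_ge0 df fL.
have := smooth_descent x ((- alpha t) *: y) L_ge0 df fL.
rewrite !dotpZr !enormZ normrN !exprMn real_normK ?num_real //.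
by case: (ger0P (dotp (grad f x) y)) => _; lra.
Qed.

Lemma stp_integral_init (h : 'rV[R]_d -> R) :
  (\int[P]_w (h (theta 1 w))%:E = (h theta1)%:E)%E.
Proof.
rewrite (eq_integral (cst (h theta1)%:E)).
  by rewrite integral_cst // [X in (_ * X)%E]probability_setT mule1.
by move=> w _; rewrite (stp_init theta_STP).
Qed.

Lemma stp_measurable_comp (h : 'rV[R]_d -> R) t : (1 <= t)%N -> continuous h ->
  measurable_fun setT (fun w => h (theta t w)).
Proof.
move=> t_ge1 h_cont.
exact: (measurableT_comp (continuous_measurable_rV h_cont) (stp_measurable t_ge1)).
Qed.

(** Expectation of the descent inequality, with [m] subtracted so that all integrands are
    nonnegative. *)
Lemma stp_energy (L muD m : R) (normD : 'rV[R]_d -> R) t : (1 <= t)%N ->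
  0 <= L -> (forall x, differentiable f x) -> smooth L f ->
  (forall x, m <= f x) -> is_norm normD -> 0 <= muD ->
  (forall v : 'rV[R]_d, (muD * normD v)%:E <= \int[D]_s `|dotp v s|%:E)%E ->
  D [set s | enorm s <= 1] = 1%E -> 0 < alpha t ->
  (\int[P]_w (f (theta t.+1 w) - m)%:E +
     (alpha t * muD)%:E * \int[P]_w (normD (grad f (theta t w)))%:E <=
   \int[P]_w (f (theta t w) - m)%:E + (L * alpha t ^+ 2)%:E)%E.
Proof.
move=> t_ge1 L_ge0 df fL m_le N_norm mu_ge0 D_lower D_unit a_gt0.
have f_cont : continuous (fun x => f x - m).
  move=> x; apply: continuousB; first exact: differentiable_continuous.
  exact: cst_continuous.
have mfm r : (1 <= r)%N -> measurable_fun setT (fun w => f (theta r w) - m).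
  by move=> r_ge1; exact: stp_measurable_comp f_cont.
have mdot : measurable_fun setT
    (fun w => `|dotp (grad f (theta t w)) (s t w)|).
  have mZ := measurable_fun_pair (stp_measurable t_ge1) (measurable_funPT (s t)).
  apply: measurableT_comp => //.
  exact: (measurableT_comp (measurable_dotp_grad fL) mZ).
have fm_ge0 r w : 0 <= f (theta r w) - m by rewrite subr_ge0.
apply: (@le_trans _ _ (\int[P]_w (f (theta t.+1 w) - m)%:E + \int[P]_w
    (alpha t * `|dotp (grad f (theta t w)) (s t w)|)%:E)%E).
  rewrite leeD2l //.
  under [in leRHS]eq_integral do rewrite EFinM.
  rewrite ge0_integralZl_EFin //; [|by apply/measurable_EFinP|exact: ltW].
  rewrite EFinM -muleA; apply: lee_wpmul2l; first by rewrite lee_fin ltW.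
  exact: (stp_integral_dotp t_ge1 fL N_norm mu_ge0 D_lower).
apply: ae_le_integralD_cst => //.
- exact: mfm.
- exact: mfm.
- exact: measurable_funM.
- by move=> w; rewrite mulr_ge0 // ltW.
- by rewrite mulr_ge0 // sqr_ge0.
- apply: filterS (stp_ae_unit t_ge1 D_unit) => w s_le1.
  have := stp_step_descent w t_ge1 L_ge0 df fL.
  (* Almost surely [s t] lies in the unit ball, which makes the error deterministic. *)
  suff : L * (alpha t * enorm (s t w : 'rV[R]_d)) ^+ 2 <= L * alpha t ^+ 2 by lra.
  rewrite ler_wpM2l // lerXn2r ?nnegrE ?mulr_ge0 ?enorm_ge0 //; try exact: ltW.
  by rewrite ler_piMr // ltW.
Qed.

Lemma stp_integral_lipschitz (C : R) (h : 'rV[R]_d -> R) t : (1 <= t)%N ->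
  0 <= C -> (forall x, 0 <= h x) ->
  (forall x y, `|h x - h y| <= C * enorm (x - y)) ->
  D [set s | enorm s <= 1] = 1%E -> 0 < alpha t ->
  (\int[P]_w (h (theta t.+1 w))%:E <=
   \int[P]_w (h (theta t w))%:E + (C * alpha t)%:E)%E.
Proof.
move=> t_ge1 C_ge0 h_ge0 hC D_unit a_gt0.
have h_cont := enorm_lipschitz_continuous hC.
(* The term [Z] of the comparison is taken to be zero. *)
have := @ae_le_integralD_cst R _ _ P (fun w => h (theta t.+1 w))
  (fun w => h (theta t w)) (cst 0) (C * alpha t).
rewrite integral0 adde0; apply=> //.
- exact: stp_measurable_comp.
- exact: stp_measurable_comp.
- by rewrite mulr_ge0 // ltW.
- apply: filterS (stp_ae_unit t_ge1 D_unit) => w s_le1 /=.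
  rewrite addr0 -lerBlDl (le_trans (ler_norm _)) // (le_trans (hC _ _)) //.
  rewrite ler_wpM2l // (le_trans (stp_step_dist w t_ge1 a_gt0)) //.
  by rewrite ler_piMr // ltW.
Qed.

End stp_process.

Theorem theorem3 (R : realType) (d : nat)
  (f : 'rV[R]_d -> R) (L : R)
  (f_diff : forall x, differentiable f x)
  (f_bounded : bounded_below f) (f_smooth : smooth L f)
  (D : probability (borel_rV R d) R)
  (D_moment2 : (\int[D]_s (enorm s ^+ 2)%:E < +oo)%E)
  (normD : 'rV[R]_d -> R) (normD_norm : is_norm normD)
  (muD : R) (muD_gt0 : 0 < muD)
  (D_lower : forall v : 'rV[R]_d,
     ((muD * normD v)%:E <= \int[D]_s `|dotp v s|%:E)%E)
  (D_unit : D [set s | enorm s <= 1] = 1%E)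
  (alpha : nat -> R) (alpha_gt0 : forall t, (1 <= t)%N -> 0 < alpha t)
  (alpha_sqr_summable : (\sum_(1 <= t <oo) (alpha t ^+ 2)%:E < +oo)%E)
  (alpha_not_summable : (\sum_(1 <= t <oo) (alpha t)%:E = +oo)%E)
  (dO : measure_display) (Omega : measurableType dO) (P : probability Omega R)
  (theta1 : 'rV[R]_d) (s : nat -> {RV P >-> borel_rV R d})
  (theta : nat -> Omega -> 'rV[R]_d)
  (theta_STP : STP f alpha D theta1 s theta) :
  ('E_P[fun w => normD (grad f (theta T w))])%E @[T --> \oo] --> 0%E.
Proof.
have [m m_le] := f_bounded.
(* The sign of [L] is not given, while the descent inequality asks for a nonnegative constant. *)
have fL : smooth `|L| f.
  move=> x y; apply: le_trans (f_smooth x y) _.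
  by rewrite ler_wpM2r ?enorm_ge0 ?ler_norm.
have L_ge0 : 0 <= `|L| by [].
have mu_ge0 := ltW muD_gt0.
have [C C_ge0 NC] := is_norm_grad_dist_le fL normD_norm.
have N_ge0 x : 0 <= normD (grad f x) by exact: is_norm_ge0.
have alpha_ge0 t : (1 <= t)%N -> 0 <= alpha t by move=> /alpha_gt0 /ltW.
have [A alpha2_le] : exists A, forall n, \sum_(0 <= t < n) alpha t.+1 ^+ 2 <= A.
  by apply: (@nneseries_partial_sum_le _ (fun t => alpha t ^+ 2)) => // t _; exact: sqr_ge0.
(* Index [t] stands for time [t.+1], so that sequences start at 0. *)
pose EF t := (\int[P]_w (f (theta t.+1 w) - m)%:E)%E.
pose EG t := (\int[P]_w (normD (grad f (theta t.+1 w)))%:E)%E.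
have EF_ge0 t : (0 <= EF t)%E.
  by apply: integral_ge0 => w _; rewrite lee_fin subr_ge0.
have EG_ge0 t : (0 <= EG t)%E by apply: integral_ge0 => w _; rewrite lee_fin.
have EF_step t := stp_energy theta_STP (isT : (1 <= t.+1)%N) L_ge0 f_diff fL m_le
  normD_norm mu_ge0 D_lower D_unit (alpha_gt0 t.+1 isT).
have EG_step t := stp_integral_lipschitz theta_STP (isT : (1 <= t.+1)%N) C_ge0
  N_ge0 NC D_unit (alpha_gt0 t.+1 isT).
(* Finiteness propagates from the deterministic start, since each step adds a finite amount. *)
have EG_fin t : EG t \is a fin_num.
  elim: t => [|t IH].
    by rewrite /EG (stp_integral_init theta_STP (fun x => normD (grad f x))).
  rewrite ge0_fin_numE //; apply: le_lt_trans (EG_step t) _.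
  by rewrite -/(EG t) -(fineK IH) -EFinD ltry.
(* The energy inequality bounds [EF t.+1] plus a nonnegative term, hence [EF t.+1] alone. *)
have EF_fin t : EF t \is a fin_num.
  elim: t => [|t IH].
    by rewrite /EF (stp_integral_init theta_STP (fun x => f x - m)).
  rewrite ge0_fin_numE //; apply: le_lt_trans; last first.
    apply: le_lt_trans (EF_step t) _.
    by rewrite -/(EF t) -(fineK IH) -EFinD ltry.
  rewrite -/(EF t.+1) leeDl // mule_ge0 ?EG_ge0 //.
  by rewrite lee_fin mulr_ge0 // alpha_ge0.
pose F t := fine (EF t); pose G t := fine (EG t).
have F_ge0 t : 0 <= F t by exact: fine_ge0.
have G_ge0 t : 0 <= G t by exact: fine_ge0.
have F_step t : F t.+1 + alpha t.+1 * muD * G t <= F t + `|L| * alpha t.+1 ^+ 2.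
  by rewrite -lee_fin !EFinD EFinM /F /G !fineK //; exact: EF_step.
have G_step t : G t.+1 <= G t + C * alpha t.+1.
  by rewrite -lee_fin EFinD /G !fineK //; exact: EG_step.
have telescope n : F n + muD * (\sum_(0 <= t < n) alpha t.+1 * G t) <=
    F 0 + `|L| * (\sum_(0 <= t < n) alpha t.+1 ^+ 2).
  elim: n => [|n IH]; first by rewrite !big_nil !mulr0 !addr0.
  by rewrite !big_nat_recr //=; have := F_step n; lra.
(* The telescoped inequality with [F n >= 0] dropped and the squared steps bounded by [A]. *)
have aG_le n : \sum_(0 <= t < n) alpha t.+1 * G t <= (F 0 + `|L| * A) / muD.
  rewrite ler_pdivlMr // mulrC.
  have := telescope n; have := F_ge0 n.
  have : `|L| * (\sum_(0 <= t < n) alpha t.+1 ^+ 2) <= `|L| * A.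
    by rewrite ler_wpM2l.
  by lra.
have G_cvg0 : G @ \oo --> (0 : R).
  apply: (@cvg0_of_weighted_summable _ (fun t => alpha t.+1) _ C _ C_ge0 _ G_ge0) aG_le G_step.
  - by move=> t; exact: alpha_gt0.
  - exact: cvg0_of_sqr_summable alpha2_le.
  - exact: nneseries_pinfty_partial_sum.
(* Undoes the index shift, since [G t] is the expectation at time [t.+1]. *)
rewrite -(cvg_shiftS (fun T => 'E_P[fun w => normD (grad f (theta T w))]%E)).
rewrite (_ : [sequence _]_n = EFin \o G).
  by apply: cvg_EFin => //; exact: nearW.
by apply/funext => t /=; rewrite /G fineK // unlock.
Qed.
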